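(* Let $A$ be a subset of an abelian group such that $|5A|=100$. Then $|4A|\ge 61$ and $|6A|\le 152$.
   Context: For an integer $h\ge 1$, $hA=\{x_1+\dots+x_h \mid x_1,\dots,x_h\in A\}$ denotes the $h$-fold iterated sumset of $A$. *)

(* Defs.v *)
From mathcomp Require Import all_boot all_algebra.
From mathcomp Require Import boolp classical_sets functions cardinality.

Set Implicit Arguments.
Unset Strict Implicit.
Unset Printing Implicit Defensive.

Local Open Scope classical_set_scope.
Local Open Scope ring_scope.

(* The h-fold iterated sumset hA, repetitions allowed; the value [set 0] at
   h = 0 is only a convention. *)
Definition iter_sumset (G : zmodType) (h : nat) (A : set G) : set G :=
  [set \sum_(i < h) x i | x in [set x : 'I_h -> G | forall i, A (x i)]].

(* Main.v *)
Require Import Defs.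
From mathcomp Require Import all_boot all_algebra.
From mathcomp Require Import finmap.
From mathcomp Require Import boolp classical_sets functions cardinality.

(** The value [macaulay d W] is the lower bound that Macaulay's theorem puts on
    the Hilbert function in degree [d] when it equals [W] in degree [d+1]. It
    satisfies
      [macaulay d+1 W <= max (W - w) (macaulay d+1 w + macaulay d (W - w))]
    for all [w <= W]; in the finite range needed here ([d < 5], [W < 154]) this is
    checked by evaluation. The theorem follows from the inequality
    [macaulay d |F| <= |H|], valid whenever [F] is contained in [(d+1)A] and [H]
    contains every [y] in [dA] such that [a + y] is in [F] for some [a] in [A].
    It is proved by induction on [A = {a} u A'] and on [d]: translating
    [F n (a + dA)] by [-a] gives a subset [F''] of [H], while the remaining part
    [F'] lies in [(d+1)A']. Splitting [H] in the same way, [H'] is admissible for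
    [F'] and [H''] for [F''], so that with [w = |F'|] one has
    [|H| >= |F''| = |F| - w] and [|H| = |H'| + |H''|]. Taking
    [F = 5A], [H = 4A] and then [F] a subset of [6A] with 153 elements, [H = 5A],
    it remains to evaluate [macaulay 4 100 = 61] and [macaulay 5 153 = 101]. *)

Set Implicit Arguments.
Unset Strict Implicit.
Unset Printing Implicit Defensive.

Import GRing.Theory.

Local Open Scope classical_set_scope.
Local Open Scope card_scope.

(* If [W] is the sum of the ['C(a_i, i)], [i <= d+1], with [a_i] decreasing (the
   greedy expansion), the value is the sum of the ['C(a_i - 1, i - 1)]. *)
Fixpoint macaulay (d W : nat) : nat :=
  let a := find (fun a => W < 'C(a.+1, d.+1)) (iota 0 (d + W)) in
  if W == 0 then 0 else
  'C(a.-1, d) + (if d is d'.+1 then macaulay d' (W - 'C(a, d.+1)) else 0).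

Lemma macaulay0 (d : nat) : macaulay d 0 = 0.
Proof. by case: d. Qed.

Lemma macaulay_deg1 (W : nat) : macaulay 0 W <= 1.
Proof. by rewrite /=; case: eqP => // _; rewrite bin0. Qed.

Lemma macaulay_split (d W w : nat) : d < 5 -> W < 154 -> w <= W ->
  macaulay d.+1 W <= maxn (W - w) (macaulay d.+1 w + macaulay d (W - w)).
Proof.
(* Tabulating the values once turns the check into table lookups. *)
pose rows := [seq mkseq (macaulay d) 154 | d <- iota 0 6].
have rowsE e v : e < 6 -> v < 154 -> nth 0 (nth [::] rows e) v = macaulay e v.
  by move=> he hv; rewrite (nth_map 0) ?size_iota // nth_iota // nth_mkseq.
have check : all (fun d => let r := nth [::] rows d.+1 in
    let r0 := nth [::] rows d in
    all (fun W => let m := nth 0 r W in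
      all (fun w => (m <= W - w) || (m <= nth 0 r w + nth 0 r0 (W - w)))
        (iota 0 W.+1))
      (iota 0 154)) (iota 0 5).
  by vm_compute.
move=> hd hW hw.
move/allP: check => /(_ d); rewrite mem_iota => /(_ hd) /allP /(_ W).
rewrite mem_iota => /(_ hW) /allP /(_ w).
rewrite mem_iota add0n ltnS => /(_ hw).
by rewrite !rowsE ?leq_max ?(leq_ltn_trans _ hW) ?leq_subr // ltnW.
Qed.

Section IterSumset.
Local Open Scope ring_scope.

Lemma iter_sumset0 (G : zmodType) (A : set G) : iter_sumset 0 A 0.
Proof. by exists (fun=> 0) => [[]|]; rewrite ?big_ord0. Qed.

Lemma sub_iter_sumset (G : zmodType) (h : nat) (A B : set G) :
  A `<=` B -> iter_sumset h A `<=` iter_sumset h B.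
Proof. by move=> AB _ [x Ax <-]; exists x => // i; apply/AB/Ax. Qed.

Lemma iter_sumsetD (G : zmodType) (h : nat) (A : set G) (a y : G) :
  A a -> iter_sumset h A y -> iter_sumset h.+1 A (a + y).
Proof.
move=> Aa [x Ax <-].
exists (fun i => if unlift ord0 i is Some j then x j else a).
  by move=> i /=; case: unliftP.
rewrite big_ord_recl unlift_none; congr (_ + _).
by apply: eq_bigr => i _; rewrite liftK.
Qed.

Lemma iter_sumset_setU1 (G : zmodType) (h : nat) (A : set G) (a z : G) :
  iter_sumset h.+1 (a |` A) z ->
  iter_sumset h.+1 A z \/ iter_sumset h (a |` A) (z - a).
Proof.
move=> [x Ax <-]; have [[i xi]|xNa] := pselect (exists i, x i = a).
  right; exists (x \o lift i) => [j|]; first exact: Ax.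
  by rewrite (bigD1_ord i) //= xi [RHS]addrC addKr.
left; exists x => // i; have [xia|//] := Ax i.
by case: xNa; exists i.
Qed.

Lemma iter_sumsetSE (G : zmodType) (h : nat) (A : set G) :
  iter_sumset h.+1 A = [set a + y | a in A & y in iter_sumset h A].
Proof.
apply/seteqP; split=> [_ [x Ax <-]|_ [a Aa [y hy <-]]]; last exact: iter_sumsetD.
exists (x ord0) => //; exists (\sum_(i < h) x (lift ord0 i)).
  by exists (x \o lift ord0) => // i; apply: Ax.
by rewrite big_ord_recl.
Qed.

Lemma iter_sumset1 (G : zmodType) (A : set G) : iter_sumset 1 A = A.
Proof.
apply/seteqP; split=> [_ [x Ax <-]|a Aa]; first by rewrite big_ord1.
by exists (fun=> a); rewrite // big_ord1.
Qed.

Lemma finite_iter_sumset (G : zmodType) (h : nat) (A : set G) :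
  finite_set A -> finite_set (iter_sumset h A).
Proof.
move=> finA; elim: h => [|h finh]; last first.
  by rewrite iter_sumsetSE; apply: finite_image2.
apply: (@sub_finite_set _ _ [set 0]) => [_ [x _ <-]|]; last exact: finite_set1.
by rewrite big_ord0.
Qed.

(** For [a] in [A], the translate of (h+2)A by [- a] contains (h+1)A, so finiteness descends to 1A =
    A. *)
Lemma finite_iter_sumset_inv (G : zmodType) (h : nat) (A : set G) :
  finite_set (iter_sumset h.+1 A) -> finite_set A.
Proof.
elim: h => [|h IH]; first by rewrite iter_sumset1.
have [->|/set0P[a Aa]] := eqVneq A set0; first by [].
move=> finA; apply: IH.
apply: (@sub_finite_set _ _ ((fun z => z - a) @` iter_sumset h.+2 A)).
  by move=> y hy; exists (a + y); [exact: iter_sumsetD | rewrite addrC addKr].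
exact: finite_image.
Qed.

End IterSumset.

Section Shift.
Local Open Scope fset_scope.
Local Open Scope ring_scope.

Lemma card_fset_shift_split (G : zmodType) (a : G) (p : pred G) (F : {fset G}) :
  (#|` [fset x in F | ~~ p (x - a)%R]|
   + #|` [fset y in [fset (x - a)%R | x in F] | p y]| = #|` F|)%N.
Proof.
have -> : [fset y in [fset x - a | x in F] | p y]
          = [fset x - a | x in [fset x in F | p (x - a)]].
  apply/fsetP => y; rewrite !inE; apply/andP/imfsetP => /=.
    by move=> [/imfsetP[x /= xF ->] py]; exists x; rewrite // !inE xF.
  move=> [x]; rewrite !inE => /andP[xF px] ->; split=> //.
  by apply/imfsetP; exists x.
rewrite [X in (_ + X)%N](card_imfset _ _ (@addIr _ (- a)%R)) /=.
rewrite -[RHS](cardfsID [fset x in F | p (x - a)] F) addnC.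
by congr (_ + _)%N; congr (#|` _|); apply/fsetP => x; rewrite !inE;
  case: (x \in F); rewrite //= ?andbT.
Qed.

Lemma macaulay_card_le (G : zmodType) (s : seq G) (d : nat) (F H : {fset G}) :
  (d < 6)%N -> (#|` F| < 154)%N ->
  {in F, forall z, iter_sumset d.+1 [set` s] z} ->
  (forall a y, a \in s -> iter_sumset d [set` s] y -> a + y \in F -> y \in H) ->
  (macaulay d #|` F| <= #|` H|)%N.
Proof.
elim: s d F H => [|a s IHs] d F H ltd ltF Fs FH.
  suff -> : F = fset0 by rewrite cardfs0 macaulay0.
  apply/fsetP => z; rewrite inE; apply/negP => /Fs[x xs _].
  by have := xs ord0.
have as_U1 : [set` a :: s] = (a |` [set` s])%classic.
  by apply/seteqP; split=> y /=; rewrite inE => /predU1P.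
have s_as : ([set` s] `<=` [set` a :: s])%classic.
  by move=> y /= ys; rewrite inE ys orbT.
have a_as : [set` a :: s]%classic a by rewrite /= mem_head.
(* [F1] below is handled with the shorter [s] in the same degree, [F2] with the same list in lower
   degree; hence the nested induction. *)
elim: d => [|d IHd] in F H ltd ltF Fs FH *.
  have [->|/fset0Pn[z zF]] := eqVneq F fset0; first by rewrite cardfs0 macaulay0.
  apply: leq_trans (macaulay_deg1 _) _; rewrite cardfs_gt0.
  apply/fset0Pn; exists 0; apply: (FH z); rewrite ?addr0 //.
    by move: (Fs z zF); rewrite iter_sumset1.
  exact: iter_sumset0.
pose p h (y : G) := `[< iter_sumset h [set` a :: s] y >].
pose F1 := [fset x in F | ~~ p d.+1 (x - a)].
pose F2 := [fset y in [fset x - a | x in F] | p d.+1 y].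
pose H1 := [fset x in H | ~~ p d (x - a)].
pose H2 := [fset y in [fset x - a | x in H] | p d y].
have cardF : (#|` F1| + #|` F2| = #|` F|)%N by exact: card_fset_shift_split.
have cardH : (#|` H1| + #|` H2| = #|` H|)%N by exact: card_fset_shift_split.
have in_shift (K : {fset G}) (y : G) :
    (y \in [fset x - a | x in K]) = (a + y \in K).
  apply/imfsetP/idP => [[x /= xK ->]|ayK]; first by rewrite addrC subrK.
  by exists (a + y); rewrite //= addrC addKr.
have F2_H : F2 `<=` H.
  apply/fsubsetP => y; rewrite !inE in_shift => /andP[yF /asboolP dy].
  exact: (FH a).
have F1_H1 : (macaulay d.+1 #|` F1| <= #|` H1|)%N.
  apply: IHs => // [|z|b y bs ys].
  - by apply: leq_ltn_trans ltF; rewrite -cardF leq_addr.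
  - rewrite !inE => /andP[zF /asboolP Nz].
    have := Fs _ zF; rewrite {1}as_U1 => /iter_sumset_setU1[//|].
    by rewrite -as_U1.
  - rewrite !inE => /andP[byF Nby]; apply/andP; split.
      apply: (FH b) => //; first by rewrite inE bs orbT.
      exact: sub_iter_sumset ys.
    (* If [y - a] were a [d]-fold sum, [b + y - a] would be a [d.+1]-fold one, excluding [b + y]
       from [F1]. *)
    apply: contra Nby => /asboolP ya; apply/asboolP.
    rewrite -addrA; apply: iter_sumsetD => //=.
    by rewrite inE bs orbT.
have F2_H2 : (macaulay d #|` F2| <= #|` H2|)%N.
  apply: IHd => [|||b y bs ys]; first exact: ltnW.
  - by apply: leq_ltn_trans ltF; rewrite -cardF leq_addl.
  - by move=> z; rewrite !inE => /andP[_ /asboolP].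
  - rewrite !inE !in_shift => /andP[abyF _]; apply/andP; split.
      (* Since [b + (a + y)] is in [F], the hypothesis on [H] applies to [a + y]. *)
      apply: (FH b) => //; first exact: iter_sumsetD.
      by rewrite addrCA.
    exact/asboolP.
have subF : (#|` F| - #|` F1| = #|` F2|)%N by rewrite -cardF addKn.
have leF1 : (#|` F1| <= #|` F|)%N by rewrite -cardF leq_addr.
apply: leq_trans (macaulay_split _ _ leF1) _ => //.
by rewrite subF geq_max fsubset_leq_card //= -cardH leq_add.
Qed.

End Shift.

Theorem proposition4p6 (G : zmodType) (A : set G)
    (h5A : iter_sumset 5 A #= `I_100) :
  (`I_61 #<= iter_sumset 4 A) /\ (iter_sumset 6 A #<= `I_152).
Proof.
have fin5 : finite_set (iter_sumset 5 A) by apply/finite_setP; exists 100.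
have finA := finite_iter_sumset_inv fin5.
have /finite_seqP[s As] := finA.
have bound (d : nat) (F : {fset G}) : (d < 6)%N -> (#|` F| < 154)%N ->
    {in F, forall z, iter_sumset d.+1 A z} ->
    (macaulay d #|` F| <= #|` fset_set (iter_sumset d A)|)%N.
  rewrite As => ltd ltF Fs; apply: (macaulay_card_le ltd ltF Fs) => a y _ ys _.
  by rewrite in_fset_set ?inE // -As; apply: finite_iter_sumset.
have card_fs h : iter_sumset h A #= `I_#|` fset_set (iter_sumset h A)|.
  rewrite -{1}(fset_setK (finite_iter_sumset h finA)).
  exact/card_eq_fsetP.
have card5 := card_fset_set h5A.
split.
  rewrite (card_le_eqr (card_fs 4)) card_le_II.
  have := bound 4 (fset_set (iter_sumset 5 A)).
  rewrite card5 => /(_ isT isT) le61.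
  (* Greedily 100 = 56+35+4+3+2, which gives 35+20+3+2+1. *)
  have <- : macaulay 4 100 = 61 by vm_compute.
  by apply: le61 => z; rewrite in_fset_set // inE.
rewrite (card_le_eql (card_fs 6)) card_le_II leqNgt; apply/negP => lt152.
(* Cutting down to exactly 153 elements keeps within the checked range; 101 then exceeds |5A| =
   100. *)
pose F := seq_fset tt (take 153 (fset_set (iter_sumset 6 A))).
have cardF : #|` F| = 153.
  by rewrite size_seq_fset undup_id ?take_uniq ?fset_uniq // size_takel.
have := bound 5 F; rewrite cardF card5 => /(_ isT isT).
have -> : macaulay 5 153 = 101 by vm_compute.
suff F6 : {in F, forall z, iter_sumset 6 A z} by move/(_ F6).
move=> z; rewrite seq_fsetE => /mem_take.
by rewrite in_fset_set ?inE //; apply: finite_iter_sumset.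
Qed.
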